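(* Let $n\in\mathbb{N}$ with $n\geq2$. There exist a switched linear system $\{A_i\}_{i=1}^m\subseteq\mathbb{R}^{n\times n}$ and a cost function $c:\mathbb{R}^n\to\mathbb{R}_{\geq0}$ such that $\mathrm{JSR}(\{A_i\}_{i=1}^m)<1$, $c$ is $C^\infty$ on $\mathbb{R}^n$ and Lipschitz continuous on a neighborhood of the origin, and the associated optimal value function $J^\star$ and worst-case value function $J^\circ$ are each non-differentiable on a dense subset of $\mathbb{R}^n$. Furthermore, the matrices $A_i$ can be chosen to have rational entries.
   Context: A discrete-time switched linear system $\{A_i\}_{i=1}^m$ is $\xi(t+1)=A_{\sigma(t)}\xi(t)$, $t\in\mathbb{N}$, with switching signal $\sigma:\mathbb{N}\to\{1,\ldots,m\}$; $\xi(t,x,\sigma)$ denotes the solution at time $t$ with $\xi(0)=x$. The joint spectral radius $\mathrm{JSR}(\{A_i\})$ is the infimum of $r\geq0$ such that there is $C\geq0$ with $\lVert\xi(t)\rVert\leq Cr^t\lVert\xi(0)\rVert$ for all solutions and all $t$. Given a cost $c:\mathbb{R}^n\to\mathbb{R}_{\geq0}$, $J(x,\sigma)=\sum_{t=0}^\infty c(\xi(t,x,\sigma))$, $J^\star(x)=\inf_\sigma J(x,\sigma)$ (optimal value function) and $J^\circ(x)=\sup_\sigma J(x,\sigma)$ (worst-case value function). *)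

(* Defs.v *)
From HB Require Import structures.
From mathcomp Require Import all_boot all_order all_algebra.
From mathcomp Require Import all_classical all_reals all_analysis.
Set Implicit Arguments. Unset Strict Implicit. Unset Printing Implicit Defensive.
Import Order.TTheory GRing.Theory Num.Theory.
Import numFieldNormedType.Exports.
Local Open Scope classical_set_scope.
Local Open Scope ring_scope.

Fixpoint traj (R : realType) (n m : nat) (A : 'I_m -> 'M[R]_n)
    (sigma : nat -> 'I_m) (x : 'cV[R]_n) (t : nat) : 'cV[R]_n :=
  match t with
  | 0 => x
  | t'.+1 => A (sigma t') *m traj A sigma x t'
  end.

Definition JSR (R : realType) (n m : nat) (A : 'I_m -> 'M[R]_n) : \bar R :=
  ereal_inf [set r%:E | r in [set r : R | 0 <= r /\
    exists C : R, 0 <= C /\ forall (x : 'cV[R]_n) (sigma : nat -> 'I_m) (t : nat),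
      `|traj A sigma x t| <= C * r ^+ t * `|x| ]].

Definition Jcost (R : realType) (n m : nat) (A : 'I_m -> 'M[R]_n)
    (c : 'cV[R]_n -> R) (x : 'cV[R]_n) (sigma : nat -> 'I_m) : \bar R :=
  (\sum_(t <oo) (c (traj A sigma x t))%:E)%E.

Definition Jstar (R : realType) (n m : nat) (A : 'I_m -> 'M[R]_n)
    (c : 'cV[R]_n -> R) (x : 'cV[R]_n) : \bar R :=
  ereal_inf [set Jcost A c x sigma | sigma in [set: nat -> 'I_m]].

Definition Jworst (R : realType) (n m : nat) (A : 'I_m -> 'M[R]_n)
    (c : 'cV[R]_n -> R) (x : 'cV[R]_n) : \bar R :=
  ereal_sup [set Jcost A c x sigma | sigma in [set: nat -> 'I_m]].

Definition e_basis (R : realType) (n : nat) (i : 'I_n) : 'cV[R]_n :=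
  delta_mx i 0.

Fixpoint Ck (R : realType) (n : nat) (k : nat) (f : 'cV[R]_n -> R) : Prop :=
  match k with
  | 0 => continuous f
  | k'.+1 => (forall (x : 'cV[R]_n) (i : 'I_n), derivable f x (@e_basis R n i)) /\
             (forall i : 'I_n, @Ck R n k' (fun x => derive f x (@e_basis R n i)))
  end.

Definition smooth (R : realType) (n : nat) (f : 'cV[R]_n -> R) : Prop :=
  forall k : nat, Ck k f.

Definition lipschitz_near0 (R : realType) (n : nat) (f : 'cV[R]_n -> R) : Prop :=
  exists U : set 'cV[R]_n, nbhs (0 : 'cV[R]_n) U /\
    exists L : R, forall x y, U x -> U y -> `|f x - f y| <= L * `|x - y|.

Definition ediff (R : realType) (n : nat) (J : 'cV[R]_n -> \bar R) (x : 'cV[R]_n) : Prop :=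
  (\forall y \near x, J y \is a fin_num) /\ differentiable (fun y => fine (J y)) x.

(* Main.v *)
Require Import Defs.
From HB Require Import structures.
From mathcomp Require Import all_boot all_order all_algebra.
From mathcomp Require Import all_classical all_reals all_analysis.
From mathcomp Require Import ring lra.
Import Order.TTheory GRing.Theory Num.Theory.
Import numFieldNormedType.Exports.
Local Open Scope classical_set_scope.
Local Open Scope ring_scope.

(** Take matrices A_0, A_1 sending x to (x_2, x_2/2, 0, ...) and
    (-x_2, x_2/2, 0, ...), and the cost c(x) = x_1^2 + g(x_1), where
    g(y) = exp(-1/y^2) sin(1/y) is odd, smooth and flat at 0. The sign chosen at
    time t only affects the cost at time t+1, so the choices decouple and
      J(x) = c(x) + (4/3) x_2^2 + e * sum_t |g(x_2 / 2^t)|,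
    with e = -1 for the optimal and e = +1 for the worst-case value function.
    Each |g(y / 2^t)| is semiconvex with a constant summable over t, so the
    upward kinks of the summands cannot cancel: the sum fails to be
    differentiable at every y = 2^t / (k pi) with k <> 0, and these are dense. *)

(** * Flat oscillating functions: a bounded family closed under differentiation *)

Section FlatOscillation.
Variable R : realType.
Implicit Types (P Q : {poly R}) (s y h : R).

(** Two polynomial coefficients in 1/y are carried because differentiating mixes the sine and cosine
    terms and brings in powers of 1/y. *)
Definition flat P Q y : R :=
  if y == 0 then 0
  else expR (- (y^-1 ^+ 2)) * (P.[y^-1] * sin y^-1 + Q.[y^-1] * cos y^-1).

Lemma poly_growth P : exists (C : R) (k : nat), 0 <= C /\
  forall s, `|P.[s]| <= C * (1 + s ^+ 2) ^+ k.+1.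
Proof.
elim/poly_ind: P => [|P c [C [k [C0 IH]]]].
  by exists 0, 0%N; split=> // s; rewrite horner0 normr0 mul0r.
exists (C + `|c|), k.+1; split=> [|s]; first exact: addr_ge0.
rewrite hornerMXaddC (le_trans (ler_normD _ _))// mulrDl lerD//.
  rewrite normrM exprSr mulrA ler_pM//.
  by rewrite ler_norml; apply/andP; split; nra.
by rewrite ler_peMr// exprn_ege1//; nra.
Qed.

(** A single term of the exponential series suffices: (1+s^2)^(k+1) <= (k+1)! exp(1+s^2) = (k+1)! e
    exp(s^2). *)
Lemma gauss_poly_bounded P : exists2 C : R, 0 <= C &
  forall s, expR (- s ^+ 2) * `|P.[s]| <= C.
Proof.
have [C [k [C0 PC]]] := poly_growth P.
exists (C * ((k.+1)`!%:R * expR 1)) => [|s].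
  by rewrite !mulr_ge0// expR_ge0.
rewrite expRN mulrC ler_pdivrMr ?expR_gt0//.
apply: (le_trans (PC s)); rewrite -!mulrA ler_wpM2l// -expRD.
have s0 : 0 <= 1 + s ^+ 2 by nra.
rewrite -ler_pdivrMl ?ltr0n ?fact_gt0// mulrC.
by apply: le_trans (expR_ge1Dxn k s0); rewrite lerDr.
Qed.

Lemma flat_bounded P Q : exists2 C : R, 0 <= C & forall y, `|flat P Q y| <= C.
Proof.
have [C C0 PC] := gauss_poly_bounded P.
have [D D0 QD] := gauss_poly_bounded Q.
exists (C + D) => [|y]; first exact: addr_ge0.
rewrite /flat; case: eqP => _; first by rewrite normr0 addr_ge0.
set s := y^-1; rewrite normrM ger0_norm ?expR_ge0//.
apply: le_trans (lerD (PC s) (QD s)); rewrite -mulrDr ler_wpM2l ?expR_ge0//.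
rewrite (le_trans (ler_normD _ _))// !normrM lerD// ler_piMr//.
  by rewrite ler_norml sin_geN1 sin_le1.
by rewrite ler_norml cos_geN1 cos_le1.
Qed.

Lemma flat0 P Q : flat P Q 0 = 0.
Proof. by rewrite /flat eqxx. Qed.

(** Splitting off a factor y stays inside the bounded family; this yields both continuity and
    differentiability at 0. *)
Lemma flat_mulX P Q y : flat P Q y = flat (P * 'X) (Q * 'X) y * y.
Proof.
rewrite /flat; case: (eqVneq y 0) => [->|y0]; first by rewrite mulr0.
by rewrite !hornerMX; field.
Qed.

Lemma flat_continuous0 P Q : {for 0, continuous (flat P Q)}.
Proof.
have [C C0 PC] := flat_bounded (P * 'X) (Q * 'X).
apply/cvgrPdist_lt => e e0; rewrite flat0; near=> y.
rewrite sub0r normrN flat_mulX normrM.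
apply: (@le_lt_trans _ _ (C * `|y|)); first by rewrite ler_wpM2r.
apply: (@le_lt_trans _ _ ((C + 1) * `|y|)); first by rewrite ler_wpM2r// lerDl.
rewrite -ltr_pdivlMl ?ltr_wpDl//.
by near: y; apply: (@nbhs0_lt R R); rewrite mulr_gt0// invr_gt0 ltr_wpDl.
Unshelve. all: by end_near. Qed.

(* flat P Q = F(1/y) with F(s) = exp(-s^2) (P(s) sin s + Q(s) cos s), so its
   derivative is -s^2 F'(s) at s = 1/y. *)
Definition dflatP P Q : {poly R} := - 'X ^+ 2 * (P^`() - 'X *+ 2 * P - Q).
Definition dflatQ P Q : {poly R} := - 'X ^+ 2 * (Q^`() - 'X *+ 2 * Q + P).

Lemma is_derive_flat P Q y :
  is_derive y 1 (flat P Q) (flat (dflatP P Q) (dflatQ P Q) y).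
Proof.
case: (eqVneq y 0) => [->|y0].
  rewrite flat0; apply/is_derive1_caratheodory.
  (* Carathéodory slope at 0: the difference quotient is itself a member of the family, continuous
     at 0 with value 0. *)
  exists (flat (P * 'X) (Q * 'X)); split; last exact: flat0.
    by move=> z; rewrite flat0 !subr0 -flat_mulX.
  exact: flat_continuous0.
pose F := (fun s : R => expR (- s ^+ 2) * (P.[s] * sin s + Q.[s] * cos s)).
have dF s : is_derive s 1 F
   (expR (- s ^+ 2) * ((P^`() - 'X *+ 2 * P - Q).[s] * sin s
     + (Q^`() - 'X *+ 2 * Q + P).[s] * cos s)).
  have de : is_derive s 1 (expR \o (fun s => - s ^+ 2))
      (expR (- s ^+ 2) * (- (s *+ 2))).
    apply: is_derive1_comp.
    apply: is_derive_eq.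
    by rewrite /GRing.scale /=; ring.
  have dp := is_deriveD (is_deriveM (is_derive_poly P s) (is_derive_sin s))
                        (is_deriveM (is_derive_poly Q s) (is_derive_cos s)).
  apply: (is_derive_eq (is_deriveM de dp)).
  rewrite /GRing.scale /= !(hornerD, hornerN, hornerM, hornerMn, hornerX).
  rewrite -[(_ * _ + _ * _ : R -> R) s]/(P.[s] * sin s + Q.[s] * cos s).
  by ring.
have dV : is_derive y 1 (fun z : R => z^-1) (- y ^- 2).
  apply: is_derive_eq; first exact: (@is_deriveV _ id y 1 1).
  by rewrite scaler1.
apply: (@near_eq_is_derive _ _ _ (F \o (fun z : R => z^-1))).
  near=> z; rewrite /flat /F/= ifN//.
  by near: z; exact: (@cvgr_neq0 _ _ _ _ _ id y cvg_id y0).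
apply: (is_derive_eq (is_derive1_comp (dF _) dV)).
rewrite /flat (negbTE y0) /dflatP /dflatQ.
rewrite !(hornerD, hornerN, hornerM, hornerMn, hornerX, horner_exp).
by field.
Unshelve. all: by end_near. Qed.

End FlatOscillation.

(** * Mean value estimates and a second-difference test for non-differentiability *)

Section SecondDifferences.
Variable R : realType.
Implicit Types (f df g dg : R -> R) (x y h : R).

Lemma mvt_dist f df a b : (forall x, is_derive x 1 f (df x)) ->
  exists2 c : R, `|c - a| <= `|b - a| & f b - f a = df c * (b - a).
Proof.
move=> fdf; have cf : continuous f.
  move=> x; apply: differentiable_continuous; apply/derivable1_diffP.
  by case: (fdf x).
have [ab|ba] := leP a b.
  have [c] := MVT_segment ab (fun x _ => fdf x) (continuous_subspaceT cf).
  by rewrite in_itv/= => /andP[ac cb] fE; exists c => //; rewrite !ger0_norm; lra.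
have [c] := MVT_segment (ltW ba) (fun x _ => fdf x) (continuous_subspaceT cf).
rewrite in_itv/= => /andP[bc ca] fE; exists c; first by rewrite !ler0_norm; lra.
by rewrite -opprB fE -mulrN opprB.
Qed.

Lemma derive_bounded_lipschitz f df M a b : (forall x, is_derive x 1 f (df x)) ->
  (forall x, `|df x| <= M) -> `|f b - f a| <= M * `|b - a|.
Proof.
move=> fdf dfM; have [c _ ->] := mvt_dist f df a b fdf.
by rewrite normrM ler_wpM2r.
Qed.

(** The mean value theorem is used twice: first on f, then on f' between y and the intermediate
    point, which is within |h| of y. *)
Lemma taylor1_bound f df ddf M : (forall x, is_derive x 1 f (df x)) ->
  (forall x, is_derive x 1 df (ddf x)) -> (forall x, `|ddf x| <= M) ->
  forall y h, `|f (y + h) - f y - h * df y| <= M * h ^+ 2.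
Proof.
move=> fdf dfd ddfM y h.
have M0 : 0 <= M by apply: le_trans (ddfM 0).
have [c] := mvt_dist f df y (y + h) fdf; rewrite addrAC subrr add0r => cy ->.
rewrite mulrC -mulrBr normrM -[h ^+ 2]real_normK ?num_real// expr2 mulrCA.
rewrite ler_wpM2l// (le_trans (derive_bounded_lipschitz _ _ _ y c dfd ddfM))//.
by rewrite ler_wpM2l.
Qed.

(** At a point of differentiability the second difference is o(h), which a lower bound of order a h
    excludes. The factor [e] lets one statement serve upward and downward kinks. *)
Lemma not_derivable_second_difference f (e a C : R) y : 0 < a ->
  (forall h, 0 < h -> a * h - C * h ^+ 2 <= e * (f (y + h) + f (y - h) - f y *+ 2)) ->
  ~ derivable f y 1.
Proof.
move=> a0 H /derivableP /is_derive1_caratheodory [q [fE cq _]].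
(* With the Carathéodory slope q, the second difference is h (q(y+h) - q(y-h)); dividing by h leaves
   a quantity that tends to 0 but should stay at least [a]. *)
have : (fun h => C * h + e * (q (y + h) - q (y - h))) @ (0 : R) --> (0 : R).
  rewrite -[X in _ --> X](_ : C * 0 + e * (q (y + 0) - q (y - 0)) = 0); last first.
    by rewrite mulr0 addr0 subr0 subrr mulr0 addr0.
  apply: cvgD; first by apply: cvgM; [exact: cvg_cst|exact: cvg_id].
  apply: cvgM; first exact: cvg_cst.
  have cp : y + h @[h --> (0 : R)] --> y.
    by rewrite -[X in _ --> X]addr0; apply: cvgD; [exact: cvg_cst|exact: cvg_id].
  have cm : y - h @[h --> (0 : R)] --> y.
    by rewrite -[X in _ --> X]subr0; apply: cvgB; [exact: cvg_cst|exact: cvg_id].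
  rewrite addr0 subr0.
  by apply: cvgB; [apply: cvg_comp cp cq|apply: cvg_comp cm cq].
move=> /cvgrPdist_lt /(_ _ a0) /nbhs_ballP [d /= d0 Hd].
have d2 : 0 < d / 2 by lra.
have : `|0 - (C * (d / 2) + e * (q (y + d / 2) - q (y - d / 2)))| < a.
  by apply: Hd; rewrite /ball/= sub0r normrN gtr0_norm//; lra.
rewrite sub0r normrN ltr_norml => /andP[_].
have := H _ d2; have := fE (y + d / 2); have := fE (y - d / 2).
move: (q _) (q _) (f (y + _)) (f (y - _)) => q2 q1 f2 f1 E1 E2 H1 H3.
have E : f2 + f1 - f y *+ 2 = (q2 - q1) * (d / 2).
  rewrite mulr2n; lra.
rewrite E in H1; nra.
Qed.

End SecondDifferences.

(** * Semiconvexity and kinks of the sum of |g(y/2^t)| *)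

Section DyadicSum.
Variables (R : realType) (g dg : R -> R) (M : R).
Hypothesis g_le_sqr : forall y, `|g y| <= y ^+ 2.
Hypothesis g_taylor : forall y h, `|g (y + h) - g y - h * dg y| <= M * h ^+ 2.
Implicit Types (y h : R) (t : nat).

Definition dyadic_sum y : R := limn (series (fun t => `|g (y / 2 ^+ t)|)).

Lemma sqr_dyadic y t : (y / 2 ^+ t) ^+ 2 = y ^+ 2 * (4^-1) ^+ t.
Proof.
by rewrite expr_div_n -exprM mulnC exprM exprVn; congr (_ / _ ^+ _); ring.
Qed.

Lemma cvg_quarter_series (a : R) :
  series (fun t => a * (4^-1) ^+ t) @ \oo --> a * (4 / 3).
Proof.
have -> : 4 / 3 = (1 - 4^-1)^-1 :> R by field.
by apply: cvg_geometric_series; rewrite ger0_norm; lra.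
Qed.

Lemma cvg_dyadic_sum y :
  series (fun t => `|g (y / 2 ^+ t)|) @ \oo --> dyadic_sum y.
Proof.
apply: (@series_le_cvg _ _ (fun t => y ^+ 2 * (4^-1) ^+ t)) => [t|t|t|].
- exact: normr_ge0.
- by apply: mulr_ge0; [exact: sqr_ge0|apply: exprn_ge0; lra].
- by rewrite -sqr_dyadic.
- by apply: cvgP; exact: cvg_quarter_series.
Qed.

(** The first-order terms at h and -h cancel, so g and -g both have second difference at least
    -2Mh^2; their maximum |g| inherits this bound. *)
Lemma abs_second_difference y h :
  - (M * h ^+ 2 *+ 2) <= `|g (y + h)| + `|g (y - h)| - `|g y| *+ 2.
Proof.
have := g_taylor y h; have := g_taylor y (- h); rewrite sqrrN.
move: (g (y + h)) (g (y - h)) (g y) => a b c.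
rewrite mulNr !ler_norml !mulr2n => /andP[? ?] /andP[? ?].
have := ler_norm a; have := ler_norm b.
have := ler_norm (- a); have := ler_norm (- b); rewrite !normrN.
by have [c0|c0] := leP 0 c; [rewrite (ger0_norm c0)|rewrite (ltr0_norm c0)]; lra.
Qed.

(** At a zero, g(y+h) and g(y-h) are h g'(y) and -h g'(y) up to Mh^2, so both absolute values are at
    least |g'(y)| h - Mh^2. *)
Lemma abs_kink y h : g y = 0 -> 0 <= h ->
  `|dg y| * h *+ 2 - M * h ^+ 2 *+ 2 <= `|g (y + h)| + `|g (y - h)|.
Proof.
move=> gy h0; have := g_taylor y h; have := g_taylor y (- h); rewrite gy sqrrN.
move: (g (y + h)) (g (y - h)) (dg y) => a b d.
rewrite mulNr !ler_norml !mulr2n !subr0 => /andP[? ?] /andP[? ?].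
have := ler_norm a; have := ler_norm b.
have := ler_norm (- a); have := ler_norm (- b); rewrite !normrN.
by have [c0|c0] := leP 0 d; [rewrite (ger0_norm c0)|rewrite (ltr0_norm c0)]; lra.
Qed.

(** The term of index t contributes its kink; all semiconvexity errors together cost at most 2Mh^2
    times the sum of 4^-s, that is (8/3)Mh^2. *)
Lemma dyadic_sum_kink y t h : g (y / 2 ^+ t) = 0 -> 0 <= h ->
  (`|dg (y / 2 ^+ t)| / 2 ^+ t *+ 2) * h - (M * (8 / 3)) * h ^+ 2 <=
  dyadic_sum (y + h) + dyadic_sum (y - h) - dyadic_sum y *+ 2.
Proof.
move=> gy h0.
(* Second difference of the s-th term, with its possible negative part compensated, so that every
   [d s] is nonnegative and the limit dominates [d t]. *)
pose d (s : nat) : R := `|g ((y + h) / 2 ^+ s)| + `|g ((y - h) / 2 ^+ s)|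
  - `|g (y / 2 ^+ s)| *+ 2 + (M * h ^+ 2 *+ 2) * (4^-1) ^+ s.
have d_ge0 s : 0 <= d s.
  have := abs_second_difference (y / 2 ^+ s) (h / 2 ^+ s).
  by rewrite -mulrDl -mulrBl sqr_dyadic /d !mulr2n; lra.
have dt : `|dg (y / 2 ^+ t)| / 2 ^+ t *+ 2 * h <= d t.
  have ht : 0 <= h / 2 ^+ t by rewrite divr_ge0// exprn_ge0.
  have := abs_kink _ _ gy ht.
  by rewrite -mulrDl -mulrBl sqr_dyadic /d gy normr0 !mulr2n; lra.
have cd : series d @ \oo --> dyadic_sum (y + h) + dyadic_sum (y - h)
    - dyadic_sum y *+ 2 + M * h ^+ 2 *+ 2 * (4 / 3).
  have -> : series d = series (fun t => `|g ((y + h) / 2 ^+ t)|)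
     + series (fun t => `|g ((y - h) / 2 ^+ t)|)
     - (series (fun t => `|g (y / 2 ^+ t)|) + series (fun t => `|g (y / 2 ^+ t)|))
     + series (fun t => M * h ^+ 2 *+ 2 * (4^-1) ^+ t).
    apply/funext => N; rewrite /series/= /d !fctE big_split/= sumrB big_split/=.
    by rewrite sumrMnl mulr2n.
  apply: cvgD; last exact: cvg_quarter_series.
  by apply: cvgB; [apply: cvgD|rewrite mulr2n; apply: cvgD]; exact: cvg_dyadic_sum.
suff : d t <= limn (series d).
  move/cvg_lim : (cd) => -> //; rewrite mulr2n; lra.
apply: limr_ge; first by apply: cvgP cd.
exists t.+1 => // N /= tN; rewrite /series/= (bigD1_seq t)/= ?iota_uniq//.
  by rewrite lerDl sumr_ge0.
by rewrite mem_index_iota.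
Qed.

End DyadicSum.

(** * The function exp(-1/y^2) sin(1/y) and the density of its dyadically scaled zeros *)

Section Oscillation.
Variable R : realType.
Implicit Types (y h : R).

Definition osc : R -> R := flat R 1 0.
Definition dosc : R -> R := flat R (dflatP R 1 0) (dflatQ R 1 0).

Lemma oscE y : y != 0 -> osc y = expR (- (y^-1 ^+ 2)) * sin y^-1.
Proof. by move=> /negPf y0; rewrite /osc /flat y0 !hornerE. Qed.

Lemma osc_odd y : osc (- y) = - osc y.
Proof.
have [->|y0] := eqVneq y 0; first by rewrite oppr0 /osc flat0 oppr0.
by rewrite !oscE ?oppr_eq0// invrN sqrrN sinN mulrN.
Qed.

(** This is exp(1/y^2) >= 1/y^2, inverted. It gives both nonnegativity of the cost and convergence
    of the dyadic sum. *)
Lemma osc_le_sqr y : `|osc y| <= y ^+ 2.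
Proof.
have [->|y0] := eqVneq y 0; first by rewrite /osc flat0 normr0 sqr_ge0.
rewrite oscE// normrM ger0_norm ?expR_ge0//.
apply: (@le_trans _ _ (expR (- (y^-1 ^+ 2)))).
  by rewrite ler_piMr ?expR_ge0// ler_norml sin_geN1 sin_le1.
have y2 : 0 < y ^+ 2 by rewrite exprn_even_gt0.
rewrite expRN -[leRHS]invrK lef_pV2 ?posrE ?expR_gt0 ?invr_gt0//.
by apply: le_trans (expR_ge1Dx _); rewrite exprVn lerDr.
Qed.

Lemma osc_lipschitz : exists M : R, forall x y, `|osc x - osc y| <= M * `|x - y|.
Proof.
have [M _ HM] := flat_bounded R (dflatP R 1 0) (dflatQ R 1 0).
exists M => x y; apply: derive_bounded_lipschitz => z; last exact: HM.
exact: is_derive_flat.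
Qed.

Lemma osc_taylor : exists M : R,
  forall y h, `|osc (y + h) - osc y - h * dosc y| <= M * h ^+ 2.
Proof.
set P := dflatP R 1 0; set Q := dflatQ R 1 0.
have [M _ HM] := flat_bounded R (dflatP R P Q) (dflatQ R P Q).
exists M; apply: taylor1_bound HM; exact: is_derive_flat.
Qed.

(** Where sin(1/y) vanishes, cos(1/y) does not, and the cosine coefficient of the derivative is
    -1/y^2. *)
Lemma osc_simple_zero y : y != 0 -> sin y^-1 = 0 -> osc y = 0 /\ dosc y != 0.
Proof.
move=> y0 sy; split; first by rewrite oscE// sy mulr0.
rewrite /dosc /flat (negPf y0) sy mulr0 add0r.
apply: mulf_neq0; first by rewrite gt_eqF ?expR_gt0.
apply: mulf_neq0.
  rewrite /dflatQ !(hornerD, hornerN, hornerM, horner_exp, hornerX).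
  rewrite deriv0 !hornerC mulr0 subr0 add0r mulr1 oppr_eq0.
  by rewrite mulf_neq0// invr_neq0.
by rewrite -sqrf_eq0 cos2sin2 sy expr0n/= subr0 oner_neq0.
Qed.

Lemma sin_pi_mulrn (k : nat) : sin (pi *+ k) = 0 :> R.
Proof. by rewrite -[_ *+ k]add0r (alternatingn (@sinDpi R)) sin0 mulr0. Qed.

(** With q = 2^t/(pi y) and k its integer part, z = 2^t/(k pi) satisfies z - y = (q-k) y/k, which is
    below e once k > y/e. *)
Lemma osc_zeros_approx_pos y (e : R) : 0 < y -> 0 < e ->
  exists (z : R) (t : nat), [/\ z != 0, `|z - y| < e & sin (z / 2 ^+ t)^-1 = 0].
Proof.
move=> y0 e0; have p0 := pi_gt0 R.
(* Chosen so that q > 1 + y/e, hence k > y/e even after truncation. *)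
pose t := Num.bound (pi * y * (1 + y / e)).
have Ht : pi * y * (1 + y / e) < 2 ^+ t := upper_nthrootP (leqnn _).
pose q : R := 2 ^+ t / (pi * y).
have py : 0 < pi * y by exact: mulr_gt0.
have q1 : 1 + y / e < q by rewrite ltr_pdivlMr// mulrC.
have ye : 0 < y / e by exact: divr_gt0.
have /andP[kq qk] := truncn_itv (ltW (lt_trans (addr_gt0 ltr01 ye) q1)).
set k := Num.trunc q in kq qk.
have ke : y / e < k%:R.
  by rewrite -(ltrD2l 1) (lt_trans q1)// nat1r.
have k0 : 0 < k%:R :> R by exact: lt_trans ke.
have tE : 2 ^+ t = q * (pi * y) by rewrite /q divfK// gt_eqF.
have t0 : 0 < 2 ^+ t :> R by rewrite exprn_gt0.
exists (2 ^+ t / (pi * k%:R)), t; split.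
- by rewrite gt_eqF// divr_gt0// mulr_gt0.
- have -> : 2 ^+ t / (pi * k%:R) - y = (q - k%:R) * y / k%:R.
    rewrite tE; move: (lt0r_neq0 p0) (lt0r_neq0 k0).
    by move: (pi : R) (k%:R : R) => p c p_neq0 c_neq0; field; rewrite c_neq0.
  rewrite normrM normfV (gtr0_norm k0) ltr_pdivrMr// ger0_norm; last first.
    by rewrite mulr_ge0 ?subr_ge0// ltW.
  move: ke; rewrite ltr_pdivrMr// mulrC; apply: le_lt_trans.
  by rewrite ler_piMl ?(ltW y0)// lerBlDr nat1r ltW.
- have -> : 2 ^+ t / (pi * k%:R) / 2 ^+ t = (pi * k%:R)^-1 :> R.
    by rewrite mulrAC divff ?mul1r// gt_eqF.
  by rewrite invrK mulr_natr sin_pi_mulrn.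
Qed.

Lemma osc_zeros_approx y (e : R) : 0 < e ->
  exists (z : R) (t : nat), [/\ z != 0, `|z - y| < e & sin (z / 2 ^+ t)^-1 = 0].
Proof.
move=> e0; have [y0|y0|->] := ltgtP y 0; last first.
(* Near y = 0, aim at e/2 with tolerance e/2. *)
- have e2 : 0 < e / 2 by lra.
  have [z [t [z0 ze sz]]] := osc_zeros_approx_pos _ _ e2 e2; exists z, t; split=> //.
  by move: ze; rewrite !ltr_norml => /andP[? ?]; lra.
- exact: osc_zeros_approx_pos.
- have Ny : 0 < - y by lra.
  have [z [t [z0 ze sz]]] := osc_zeros_approx_pos _ _ Ny e0.
  exists (- z), t; split; first by rewrite oppr_eq0.
    by rewrite -opprD normrN -[y]opprK.
  by rewrite mulNr invrN sinN sz oppr0.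
Qed.

End Oscillation.

(** * The entrywise maximum norm, and smoothness of functions of one coordinate *)

Section MatrixNorm.
Variables (R : realType) (m n : nat).
Implicit Type x : 'M[R]_(m, n).

Lemma mx_entry_le_norm x i j : `|x i j| <= `|x|.
Proof.
by rewrite [`|x|]mx_normrE; apply: (le_bigmax _ (fun ij => `|x ij.1 ij.2|) (i, j)).
Qed.

Lemma mx_norm_le x (c : R) : 0 <= c -> (forall i j, `|x i j| <= c) -> `|x| <= c.
Proof. by move=> c0 xc; rewrite [`|x|]mx_normrE; apply: bigmax_le. Qed.

End MatrixNorm.

(** [F] lists a function with its successive derivatives. Each partial derivative is the shifted
    sequence in the same coordinate, or zero, so the induction must quantify over [F]. *)
Lemma Ck_coord (R : realType) (n : nat) (i0 : 'I_n) (k : nat) (F : nat -> R -> R) :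
  (forall j (y : R), is_derive y 1 (F j) (F j.+1 y)) ->
  Ck k (fun x : 'cV[R]_n => F 0%N (x i0 0)).
Proof.
elim: k F => [|k IH] F dF /=.
  move=> x; apply: (@continuous_comp _ _ _ (fun x : 'cV[R]_n => x i0 0)).
    exact: coord_continuous.
  apply: differentiable_continuous; apply/derivable1_diffP.
  by case: (dF 0%N (x i0 0)).
have quotE i x : (fun h : R => h^-1 *: (F 0%N ((h *: e_basis R i + x) i0 0) - F 0%N (x i0 0)))
    = (fun h : R => h^-1 *: (F 0%N (h *: ((i0 == i)%:R : R) + x i0 0) - F 0%N (x i0 0))).
  by apply/funext => h; rewrite !mxE eqxx andbT.
have derE i x : derive (fun x : 'cV[R]_n => F 0%N (x i0 0)) x (e_basis R i)
    = derive (F 0%N) (x i0 0) ((i0 == i)%:R : R).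
  by rewrite /derive quotE.
have [dbl drv] : (forall y : R, derivable (F 0%N) y 1)
    /\ (forall y : R, derive (F 0%N) y 1 = F 1%N y).
  by split=> y; case: (dF 0%N y).
split=> [x i|i].
  rewrite /derivable quotE.
  by case: (i0 == i); [exact: dbl|exact: derivable0].
have -> : (fun x => derive (fun x : 'cV[R]_n => F 0%N (x i0 0)) x (e_basis R i))
    = (fun x => (if i0 == i then F 1%N else cst 0) (x i0 0)).
  apply/funext => x; rewrite derE; case: (i0 == i); first exact: drv.
  exact: derive0.
case: (i0 == i).
  exact: (IH (fun j => F j.+1)).
by apply: (IH (fun _ => cst 0)) => j y; exact: is_derive_cst.
Qed.

(** * The two-mode system, its value functions and their non-differentiability *)

Section Example.
Variables (R : realType) (n : nat) (i0 i1 : 'I_n).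
Hypothesis i01 : i0 != i1.
Implicit Types (x : 'cV[R]_n) (sigma : nat -> 'I_2).

(** [i0] and [i1] stand for the first and second coordinates; the modes differ only in the sign of
    one entry. *)
Definition switchQ (i : 'I_2) : 'M[rat]_n := \matrix_(a, b)
  (if b == i1 then
     if a == i0 then (-1) ^+ i else if a == i1 then 2^-1 else 0
   else 0).

Let A (i : 'I_2) : 'M[R]_n := map_mx (fun q : rat => ratr q : R) (switchQ i).

Definition cost x : R := x i0 0 ^+ 2 + osc R (x i0 0).

Lemma mul_switch i x : A i *m x = \col_a
  (if a == i0 then (-1) ^+ i * x i1 0 else if a == i1 then x i1 0 / 2 else 0).
Proof.
apply/matrixP => a b; rewrite !mxE (bigD1 i1)//= big1 ?addr0.
  rewrite !mxE eqxx !ord1; case: ifP => _.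
    by rewrite rmorphXn/= rmorphN1.
  case: ifP => _; last by rewrite rmorph0 mul0r.
  by rewrite fmorphV/= ratr_nat mulrC.
by move=> j /negPf j1; rewrite !mxE j1 rmorph0 mul0r.
Qed.

Lemma traj_coord1 sigma x t : traj A sigma x t i1 0 = x i1 0 / 2 ^+ t.
Proof.
elim: t => [|t IH] /=; first by rewrite expr0 divr1.
by rewrite mul_switch !mxE eq_sym (negPf i01) eqxx IH exprSr invfM mulrA.
Qed.

(** Only the last choice [sigma t] is visible in the state, through one sign: this is what decouples
    the choices. *)
Lemma trajS sigma x t : traj A sigma x t.+1 = \col_a
  (if a == i0 then (-1) ^+ sigma t * (x i1 0 / 2 ^+ t)
   else if a == i1 then x i1 0 / 2 ^+ t.+1 else 0).
Proof.
rewrite /= mul_switch traj_coord1; apply/matrixP => a b; rewrite !mxE.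
by rewrite exprSr invfM (mulrA (x i1 0)).
Qed.

Lemma switch_JSR : (JSR A < 1%:E)%E.
Proof.
apply: (@le_lt_trans _ _ (2^-1)%:E); last by rewrite lte_fin; lra.
apply: ereal_inf_lbound; exists 2^-1 => //; split; first by lra.
(* The constant 2 pays for the first step, which need not contract: at time t+1 the bound is
   |x|/2^t. *)
exists 2; split=> // x sigma [|t].
  by rewrite expr0 mulr1/= ler_peMl//; lra.
have xt : 0 <= 2^-1 ^+ t * `|x| by rewrite mulr_ge0// exprn_ge0//; lra.
have -> : 2 * 2^-1 ^+ t.+1 * `|x| = 2^-1 ^+ t * `|x| by rewrite exprS; field.
apply: mx_norm_le => // a b; rewrite trajS !mxE.
have x1 : `|x i1 0 / 2 ^+ t| <= 2^-1 ^+ t * `|x|.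
  rewrite normrM mulrC normfV normrX normr_nat exprVn.
  by rewrite ler_wpM2l ?mx_entry_le_norm// invr_ge0 exprn_ge0.
case: ifP => _; first by rewrite normrM normrX normrN1 expr1n mul1r.
case: ifP => _; last by rewrite normr0.
rewrite exprSr invfM mulrA normrM (le_trans _ x1)// ler_piMr//.
by rewrite ger0_norm; lra.
Qed.

Lemma cost_ge0 x : 0 <= cost x.
Proof.
have := osc_le_sqr R (x i0 0); rewrite ler_norml => /andP[? _].
by rewrite /cost; lra.
Qed.

Lemma cost_smooth : smooth cost.
Proof.
(* [pq k] holds the coefficient polynomials of the k-th derivative of [osc]. *)
pose step (pq : {poly R} * {poly R}) := (dflatP R pq.1 pq.2, dflatQ R pq.1 pq.2).
pose pq k := iter k step (1, 0).
pose F k := horner (('X^2)^`(k) : {poly R}) + flat R (pq k).1 (pq k).2.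
move=> k.
have -> : cost = (fun x => F 0%N (x i0 0)).
  by apply/funext => x; rewrite /cost /F fctE derivn0 hornerXn.
apply: Ck_coord => j y; rewrite /F.
by apply: is_deriveD; exact: is_derive_flat.
Qed.

Lemma cost_lipschitz : lipschitz_near0 cost.
Proof.
have [M HM] := osc_lipschitz R.
exists (ball 0 1); split; first exact: nbhsx_ballx.
(* On the unit ball the square has Lipschitz constant 2; [|M|] covers [osc], since the sign of [M]
   is not given. *)
exists (2 + `|M|) => x y; rewrite -ball_normE /ball_/= !sub0r !normrN => x1 y1.
rewrite /cost opprD addrACA (le_trans (ler_normD _ _))// mulrDl.
have xy : `|x i0 0 - y i0 0| <= `|x - y|.
  by have := mx_entry_le_norm R _ _ (x - y) i0 0; rewrite !mxE.
apply: lerD.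
  rewrite subr_sqr normrM mulrC ler_pM//.
  have := mx_entry_le_norm R _ _ x i0 0; have := mx_entry_le_norm R _ _ y i0 0.
  by move=> ? ?; rewrite (le_trans (ler_normD _ _))//; lra.
rewrite (le_trans (HM _ _))// (le_trans (ler_wpM2r _ (ler_norm M)))//.
by rewrite ler_wpM2l.
Qed.

(* The smallest (e = -1) and largest (e = 1) cost achievable at time t. *)
Definition extremal_cost (e : R) x t : R :=
  if t is s.+1 then (x i1 0 / 2 ^+ s) ^+ 2 + e * `|osc R (x i1 0 / 2 ^+ s)|
  else cost x.

(** Closed form of the summed extremal costs, with 4/3 the sum of 4^-t. *)
Definition value (e : R) x : R :=
  cost x + x i1 0 ^+ 2 * (4 / 3) + e * dyadic_sum R (osc R) (x i1 0).

Lemma extremal_cost_sum e x :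
  (\sum_(t <oo) (extremal_cost e x t)%:E = (value e x)%:E)%E.
Proof.
apply: cvg_lim => //.
have -> : (fun N => \sum_(0 <= t < N) (extremal_cost e x t)%:E)%E
    = EFin \o (fun N => \sum_(0 <= t < N) extremal_cost e x t).
  by apply/funext => N; rewrite /= sumEFin.
apply/fine_cvgP; split; first exact: nearW.
have -> : fine \o (EFin \o (fun N => \sum_(0 <= t < N) extremal_cost e x t))
  = (fun N => \sum_(0 <= t < N) extremal_cost e x t) by [].
(* The shift isolates the cost at time 0, which no choice affects. *)
rewrite -cvg_shiftS /=.
have -> : (fun N => \sum_(0 <= t < N.+1) extremal_cost e x t) =
    cst (cost x) + series (fun t => x i1 0 ^+ 2 * (4^-1) ^+ t)
      + (fun N => e * series (fun t => `|osc R (x i1 0 / 2 ^+ t)|) N).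
  apply/funext => N; rewrite big_nat_recl//= !fctE -addrA; congr (_ + _).
  rewrite /series/= mulr_sumr -big_split/=; apply: eq_bigr => t _.
  by rewrite sqr_dyadic.
apply: cvgD; first (apply: cvgD; first exact: cvg_cst).
  exact: cvg_quarter_series.
apply: cvgM; first exact: cvg_cst.
by apply: cvg_dyadic_sum; exact: osc_le_sqr.
Qed.

Lemma cost_trajS sigma x t : cost (traj A sigma x t.+1) =
  (x i1 0 / 2 ^+ t) ^+ 2 + (-1) ^+ sigma t * osc R (x i1 0 / 2 ^+ t).
Proof.
rewrite /cost trajS !mxE eqxx.
case: (sigma t) => -[|[|//]] /= _; rewrite ?expr0 ?expr1 ?mulN1r ?mul1r//.
by rewrite sqrrN osc_odd.
Qed.

Lemma extremal_costP sigma x t :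
  extremal_cost (-1) x t <= cost (traj A sigma x t) <= extremal_cost 1 x t.
Proof.
case: t => [|t]; first by rewrite /= !lexx.
rewrite cost_trajS /= mulN1r mul1r !lerD2l.
by rewrite -ler_norml normrM normrX normrN1 expr1n mul1r.
Qed.

Lemma extremal_cost_attained (b : bool) x : exists sigma, forall t,
  cost (traj A sigma x t) = extremal_cost ((-1) ^+ b) x t.
Proof.
(* The mode multiplies [osc] by its own sign, giving |osc|, and by a further -1 when [b] is true. *)
exists (fun t => inord (b (+) (osc R (x i1 0 / 2 ^+ t) < 0)%R)) => -[//|t].
rewrite cost_trajS inordK; last by case: (_ (+) _).
congr (_ + _); rewrite signr_addb -mulrA; congr (_ * _).
by rewrite -normrEsign.
Qed.

(** One signal attains every stagewise minimum simultaneously, so the infimum of the sums is the sum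
    of the minima. *)
Lemma JstarE x : Jstar A cost x = (value (-1) x)%:E.
Proof.
rewrite -extremal_cost_sum; apply/eqP; rewrite eq_le; apply/andP; split.
  apply: ereal_inf_lbound; have [sigma H] := extremal_cost_attained true x.
  by exists sigma => //; apply: eq_eseriesr => t _; rewrite H expr1.
apply/ereal_infP => _ [sigma _ <-]; apply: lee_nneseries => t.
  move=> _ _; have [tau H] := extremal_cost_attained true x.
  by rewrite lee_fin -[-1]expr1 -(H t) cost_ge0.
by move=> _; rewrite lee_fin; have /andP[] := extremal_costP sigma x t.
Qed.

Lemma JworstE x : Jworst A cost x = (value 1 x)%:E.
Proof.
rewrite -extremal_cost_sum; apply/eqP; rewrite eq_le; apply/andP; split.
  apply/ereal_supP => _ [sigma _ <-]; apply: lee_nneseries => t.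
    by move=> _ _; rewrite lee_fin cost_ge0.
  by move=> _; rewrite lee_fin; have /andP[] := extremal_costP sigma x t.
apply: ereal_sup_ubound; have [sigma H] := extremal_cost_attained false x.
by exists sigma => //; apply: eq_eseriesr => t _; rewrite H expr0.
Qed.

Lemma value_not_differentiable (b : bool) x t : x i1 0 != 0 ->
  sin (x i1 0 / 2 ^+ t)^-1 = 0 -> ~ differentiable (value ((-1) ^+ b)) x.
Proof.
(* Restrict to the line along [i1], on which [cost] is constant. *)
move=> x0 sx /(@diff_derivable _ _ _ _ _ (e_basis R i1)) /derivable1P.
set y := x i1 0 in x0 sx *; set e : R := (-1) ^+ b.
have t0 : 2 ^+ t != 0 :> R by rewrite expf_neq0.
have [|gy dgy] := osc_simple_zero R (y / 2 ^+ t) _ sx.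
  by rewrite mulf_neq0// invr_neq0.
have [M HM] := osc_taylor R.
(* Multiplying by [e] turns the kink upward, as e^2 = 1. The extra 8/3 absorbs the second difference
   of the quadratic term, which has the wrong sign when e = -1. *)
apply: (@not_derivable_second_difference _ _ e
  (`|dosc R (y / 2 ^+ t)| / 2 ^+ t *+ 2) (M * (8 / 3) + 8 / 3)).
  by rewrite pmulrn_lgt0// divr_gt0 ?normr_gt0// exprn_gt0.
move=> h h0.
have vE (k : R) : value e (k *: e_basis R i1 + x) =
    cost x + (y + k) ^+ 2 * (4 / 3) + e * dyadic_sum R (osc R) (y + k).
  by rewrite /value /cost !mxE (negPf i01) !eqxx /= mulr0 mulr1 add0r (addrC k).
rewrite !vE !add0r addr0.
have := dyadic_sum_kink R (osc R) (dosc R) M (osc_le_sqr R) HM y t h gy (ltW h0).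
set D := dyadic_sum R (osc R) (y + h); set D' := dyadic_sum R (osc R) (y - h).
set D0 := dyadic_sum R (osc R) y; set a := _ *+ 2 * h.
rewrite /e; case: (b); rewrite ?expr0 ?expr1 !mulr2n => H; nra.
Qed.

Lemma value_nondiff_dense (b : bool) (J : 'cV[R]_n -> \bar R) :
  (forall x, J x = (value ((-1) ^+ b) x)%:E) -> dense [set x | ~ ediff J x].
Proof.
move=> JE O [x Ox] oO.
have /nbhs_ballP[e /= e0 He] : nbhs x O by exact: open_nbhs_nbhs.
have [z [t [z0 ze sz]]] := osc_zeros_approx R (x i1 0) e e0.
(* Only coordinate [i1] moves, so the distance to x is at most |z - x_2|. *)
pose x' := x + (z - x i1 0) *: e_basis R i1.
have x'1 : x' i1 0 = z by rewrite !mxE !eqxx mulr1 addrC subrK.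
exists x'; split.
  apply: He; rewrite -ball_normE /ball_/= opprD addNKr normrN.
  apply: le_lt_trans ze; apply: mx_norm_le => // i j; rewrite !mxE normrM.
  by rewrite ler_piMr//; case: (_ && _); rewrite ?normr1 ?normr0.
case=> _; have -> : (fun y => fine (J y)) = value ((-1) ^+ b).
  by apply/funext => y; rewrite JE.
by apply: (value_not_differentiable _ _ t); rewrite x'1.
Qed.

End Example.

Theorem theorem3 (R : realType) (n : nat) (hn : (2 <= n)%N) :
  exists (m : nat) (Q : 'I_m -> 'M[rat]_n) (c : 'cV[R]_n -> R),
    let A := fun i => map_mx (fun q : rat => ratr q : R) (Q i) in
    (0 < m)%N /\
    (forall x, 0 <= c x) /\
    (JSR A < 1%:E)%E /\
    smooth c /\ lipschitz_near0 c /\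
    (forall x, Jstar A c x \is a fin_num) /\
    (forall x, Jworst A c x \is a fin_num) /\
    dense [set x | ~ ediff (Jstar A c) x] /\
    dense [set x | ~ ediff (Jworst A c) x].
Proof.
(* The bound n >= 2 supplies two distinct coordinates. *)
pose i0 : 'I_n := Ordinal (ltnW hn); pose i1 : 'I_n := Ordinal hn.
have i01 : i0 != i1 by [].
exists 2, (switchQ n i0 i1), (cost R n i0) => A.
split=> //; split; first exact: cost_ge0.
split; first exact: switch_JSR.
split; first exact: cost_smooth.
split; first exact: cost_lipschitz.
split; first by move=> x; rewrite JstarE.
split; first by move=> x; rewrite JworstE.
split.
  by apply: (value_nondiff_dense _ _ _ _ i01 true) => x; rewrite JstarE// expr1.
by apply: (value_nondiff_dense _ _ _ _ i01 false) => x; rewrite JworstE.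
Qed.
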